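(* Suppose finitely many circuits $i=1,\dots,n$ ($n\ge 1$) are responsible for solving a task, and let $\mathrm{PU}_i(N)\in(0,1)$ be the success rate of circuit $i$ as a function of the model size $N>0$. Suppose each circuit displays scaling law growth, i.e. there are constants $c_i>0$, $\alpha_i>0$ with $\mathrm{PU}_i(N)=\exp(-c_iN^{-\alpha_i})$ for all $N>0$. Suppose the success rate of the task is $\max_i \mathrm{PU}_i(N)$, so that $F(N)=\log\left(-\log\max_i \mathrm{PU}_i(N)\right)$. Then $F(N)$ is a concave function of $\log N$.
   Context: $N$ is the number of non-embedding parameters of a model, treated as a continuous positive variable. For a success rate $\mathrm{PU}(N)\in(0,1)$ that is a continuous function of $N$, put $F(N)=\log(-\log(\mathrm{PU}(N)))$. The success rate displays scaling law growth if $F(N)$ is a linear (affine) function of $\log N$, i.e. $F(N)=\log c-\alpha\log N$, equivalently $\mathrm{PU}(N)=\exp(-cN^{-\alpha})$, where the coefficients $c,\alpha$ are positive. Concavity is not required to be strict. *)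

(* Defs.v *)
From HB Require Import structures.
From mathcomp Require Import all_boot all_order all_algebra.
From mathcomp Require Import all_classical all_reals all_analysis.

Set Implicit Arguments.
Unset Strict Implicit.
Unset Printing Implicit Defensive.

Import Order.TTheory GRing.Theory Num.Theory.
Import numFieldNormedType.Exports.

Local Open Scope classical_set_scope.
Local Open Scope ring_scope.

(* Functions of the model size N are total on R; only their values at N > 0
   are meaningful, and the properties below constrain only those. *)

Definition success_rate (R : realType) (PU : R -> R) : Prop :=
  (forall N : R, 0 < N -> 0 < PU N < 1) /\
  {within `]0, +oo[%classic, continuous PU}.

Definition scaling_law_growth (R : realType) (PU : R -> R) : Prop :=
  exists c alpha : R, [/\ 0 < c, 0 < alpha &
    forall N : R, 0 < N -> PU N = expR (- (c * N `^ (- alpha)))].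

Definition loglog (R : realType) (PU : R -> R) (N : R) : R :=
  ln (- ln (PU N)).

(* The bigop starts from 0, which does not affect the value when n > 0 and
   all the PU i N are positive, as is the case for success rates. *)
Definition max_rate (R : realType) (n : nat) (PU : 'I_n -> R -> R) (N : R) : R :=
  \big[Num.max/0]_(i < n) PU i N.

(* The convex_function of the library takes its convex combinations in R^o
   seen as a module over R. *)
Definition concave_function (R : realType) (D : set R) (g : R -> R) : Prop :=
  @convex_function R R^o D (fun x => - g x).

(* The variable log N ranges over the whole real line as N ranges over the
   positive reals, hence the domain setT. *)
Definition concave_in_log (R : realType) (F : R -> R) : Prop :=
  exists g : R -> R,
    concave_function setT g /\ forall N : R, 0 < N -> F N = g (ln N).

(* Main.v *)
(* In the variable x = log N each circuit has the affine double logarithm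
   ln c_i - alpha_i x.  Since p |-> ln (- ln p) is decreasing on ]0, 1[, it
   turns the maximum of the success rates into the minimum of these affine
   functions, and a minimum of affine functions is concave. *)
Require Import Defs.
From HB Require Import structures.
From mathcomp Require Import all_boot all_order all_algebra.
From mathcomp Require Import all_classical all_reals all_analysis.
From mathcomp Require Import lra.

Import Order.TTheory GRing.Theory Num.Theory.

Local Open Scope ring_scope.

(** An affine function attaining [g] at the convex combination takes there the same combination of
    its values at [x] and [y], and these are at least [g x] and [g y]. *)
Lemma concave_min_affine (R : realType) (I : Type) (a b : I -> R) (g : R -> R) :
  (forall x i, g x <= b i + a i * x) ->
  (forall x, exists i, g x = b i + a i * x) ->
  concave_function setT g.
Proof.
move=> g_le g_attained t x y _ _; rewrite convRE.
have -> : conv t x y = t%:num * x + (1 - t%:num) * y by exact: convRE.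
have [i ->] := g_attained (t%:num * x + (1 - t%:num) * y).
have t_ge0 : 0 <= t%:num by [].
have t_le1 : 0 <= 1 - t%:num by rewrite subr_ge0.
have := ler_wpM2l t_ge0 (g_le x i).
have := ler_wpM2l t_le1 (g_le y i).
rewrite /unstable.onem; nra.
Qed.

(** Both logarithms preserve order and the inner negation reverses it; [p < 1] makes [- ln p]
    positive, so that the outer [ln] is strictly increasing there. *)
Lemma le_lnNln (R : realType) :
  {in [pred p : R | 0 < p < 1] &, {mono (fun p => ln (- ln p)) : p q /~ p <= q}}.
Proof.
move=> p q /andP[p_gt0 p_lt1] /andP[q_gt0 q_lt1].
by rewrite ler_ln ?posrE ?oppr_gt0 ?ln_lt0 ?p_gt0 ?q_gt0// lerN2 ler_ln.
Qed.

Lemma loglog_scaling_law (R : realType) (PU : R -> R) (c alpha x : R) :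
  0 < c -> PU (expR x) = expR (- (c * expR x `^ (- alpha))) ->
  loglog PU (expR x) = ln c + - alpha * x.
Proof.
move=> c_gt0 PUE; rewrite /loglog PUE expRK opprK.
by rewrite lnM ?posrE ?powR_gt0 ?expR_gt0// ln_powR expRK.
Qed.

(** The initial value [0] of the bigop lies below every rate, and there is at least one index. *)
Lemma max_rate_attained (R : realType) (n : nat) (PU : 'I_n -> R -> R) (N : R) :
  (0 < n)%N -> (forall i, 0 < PU i N) -> exists i, max_rate PU N = PU i N.
Proof.
case: n PU => // n PU _ PU_gt0.
have [i _ iE] := eq_bigmax ord0 xpredT (fun i => PU i N) isT
  (fun i _ => ltW (PU_gt0 i)).
by exists i.
Qed.

Theorem theorem3 (R : realType) (n : nat) (n_gt0 : (0 < n)%N)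
    (PU : 'I_n -> R -> R)
    (PU_rate : forall i : 'I_n, success_rate (PU i))
    (PU_scaling : forall i : 'I_n, scaling_law_growth (PU i))
    (PU_task : R -> R)
    (PU_taskE : forall N : R, 0 < N -> PU_task N = max_rate PU N) :
  concave_in_log (loglog PU_task).
Proof.
(* Substituting [N = expR x] expresses the function in the variable [x = ln N]. *)
exists (loglog PU_task \o expR); split; last first.
  by move=> N N_gt0 /=; rewrite lnK.
have [c /choice[alpha PUE]] := choice PU_scaling.
have PU_itv i x : 0 < PU i (expR x) < 1 by apply: (PU_rate i).1; rewrite expR_gt0.
have loglogE i x : loglog (PU i) (expR x) = ln (c i) + - alpha i * x.
  by have [c_gt0 _ E] := PUE i; apply: loglog_scaling_law => //; rewrite E ?expR_gt0.
have taskE x : exists i, PU_task (expR x) = PU i (expR x).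
  rewrite PU_taskE ?expR_gt0//; apply: max_rate_attained => // i.
  by have /andP[] := PU_itv i x.
apply: (@concave_min_affine _ _ (fun i => - alpha i) (fun i => ln (c i))) => x.
  move=> j; rewrite -loglogE /= /loglog.
  (* Being the rate of some circuit [i], the task rate lies in []0, 1[], so the order-reversing
     lemma applies and leaves [PU j] at most the maximum. *)
  have [i taskEi] := taskE x.
  rewrite le_lnNln ?inE ?taskEi ?PU_itv//.
  by rewrite -taskEi PU_taskE ?expR_gt0// le_bigmax.
by have [i taskEi] := taskE x; exists i; rewrite -loglogE /= /loglog taskEi.
Qed.
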